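(* Let $L:\mathbb{R}^n\times\mathbb{R}^m\to\mathbb{R}\cup\{\infty\}$, $L(x,y)=f(x)+Q(x,y)+g(y)$, and let $(x_0,y_0)\in\mathbb{R}^n\times\mathbb{R}^m$ and positive sequences $\{\lambda_k\},\{\mu_k\}$ be such that assumptions $(\mathcal{H})$ and $(\mathcal{H}_1)$ (stated in the context) hold. Let $\{(x_k,y_k)\}$ be a sequence generated from $(x_0,y_0)$ by the alternating minimization algorithm \[ x_{k+1}\in\arg\min_{u\in\mathbb{R}^n}\Big\{L(u,y_k)+\frac{1}{2\lambda_k}\|u-x_k\|^2\Big\},\qquad y_{k+1}\in\arg\min_{v\in\mathbb{R}^m}\Big\{L(x_{k+1},v)+\frac{1}{2\mu_k}\|v-y_k\|^2\Big\}. \] Suppose that $\{(x_k,y_k)\}$ converges to an $M$-stationary point $(x^\ast,y^\ast)$ of $L$, i.e. $0\in\partial_M L(x^\ast,y^\ast)$, and that $L$ satisfies the exponent PLK condition at $(x^\ast,y^\ast)$ with $\varphi(t)=Mt^{1-q}$, where $q\in[0,1)$ and $M>0$. Then: (i) If $q=0$, then $\{(x_k,y_k)\}$ converges in a finite number of steps. (ii) If $q\in(0,\tfrac12)$, then $\{(x_k,y_k)\}$ either has finite termination or converges superlinearly to $(x^\ast,y^\ast)$. (iii) If $q=\tfrac12$, then $\{(x_k,y_k)\}$ converges linearly to $(x^\ast,y^\ast)$. (iv) If $q\in(\tfrac12,1)$, then there exists $\gamma>0$ such that \[ \|(x_k,y_k)-(x^\ast,y^\ast)\|\le\gamma\,k^{-\frac{1-q}{2q-1}}\quad\text{for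 all } k\in\mathbb{N}=\{1,2,\dots\}. \]
   Context: Assumptions $(\mathcal{H})$: $L(x,y)=f(x)+Q(x,y)+g(y)$, where $f:\mathbb{R}^n\to\mathbb{R}\cup\{\infty\}$ and $g:\mathbb{R}^m\to\mathbb{R}\cup\{\infty\}$ are proper (i.e. finite at some point) and lower semicontinuous, not necessarily convex; $Q:\mathbb{R}^n\times\mathbb{R}^m\to\mathbb{R}$ is $C^1$-smooth; and $\nabla Q$ is Lipschitz continuous on bounded subsets of $\mathbb{R}^n\times\mathbb{R}^m$. Assumptions $(\mathcal{H}_1)$: $\inf_{\mathbb{R}^n\times\mathbb{R}^m}L>-\infty$; the function $L(\cdot,y_0)$ is proper; and for some positive numbers $r_-<r_+$ all stepsizes $\lambda_k,\mu_k$ belong to $(r_-,r_+)$. Subdifferential. For a proper function $h:\mathbb{R}^d\to\mathbb{R}\cup\{\infty\}$ with $\operatorname{dom}h=\{x: h(x)<\infty\}$, the regular (Fréchet) subdifferential at $x\in\operatorname{dom}h$ is \[ \partial_F h(x)=\Big\{v:\ \liminf_{u\to x,\,u\ne x}\frac{h(u)-h(x)-\langle v,u-x\rangle}{\|u-x\|}\ge0\Big\}, \] and the limiting (Mordukhovich) subdifferential $\partial h(\bar x)=\partial_M h(\bar x)$ at $\bar x\in\operatorname{dom}h$ is the set of all $v$ for which there exist $x_k\to\bar x$ with $h(x_k)\to h(\bar x)$ and $v_k\in\partial_F h(x_k)$ with $v_k\to v$. The convention $\operatorname{dist}(0,\emptyset)=\infty$ is used. Exponent PLK (Polyak–Łojasiewicz–Kurdyka)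 condition. A lower semicontinuous function $h:\mathbb{R}^d\to\mathbb{R}\cup\{\infty\}$ satisfies the exponent PLK condition at $\bar x\in\operatorname{dom}h$ with $\varphi(t)=Mt^{1-q}$, $M>0$, $q\in[0,1)$, if there exist $\eta\in(0,\infty)$ and a neighborhood $U$ of $\bar x$ such that \[ \varphi'\big(h(x)-h(\bar x)\big)\,\operatorname{dist}\big(0,\partial h(x)\big)\ge1\quad\text{for all }x\in U\text{ with }h(\bar x)<h(x)<h(\bar x)+\eta . \] Convergence notions. Write $z_k=(x_k,y_k)$ and $z^\ast=(x^\ast,y^\ast)$. ''Convergence in a finite number of steps'' and ''finite termination'' mean that $z_k=z^\ast$ for all sufficiently large $k$. ''Superlinear convergence'' means $\|z_k-z^\ast\|/\|z_{k-1}-z^\ast\|\to0$ as $k\to\infty$. ''Linear convergence'' of the iterates means that there exist $c>0$ and $\tau\in[0,1)$ with $\|z_k-z^\ast\|\le c\,\tau^k$ for all $k\in\mathbb{N}$. *)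

(* Defs.v *)
From HB Require Import structures.
From mathcomp Require Import all_boot all_order all_algebra.
From mathcomp Require Import all_classical all_reals all_analysis.

Set Implicit Arguments.
Unset Strict Implicit.
Unset Printing Implicit Defensive.

Import Order.TTheory GRing.Theory Num.Theory.
Import numFieldNormedType.Exports.

Local Open Scope classical_set_scope.
Local Open Scope ring_scope.

(* R^d is 'rV[R]_d and R^n x R^m is 'rV[R]_(n + m), with (x, y) encoded as
   row_mx x y.  The library norm `|_| on 'rV[R]_d is the sup norm: it is used
   only through the topology and the bounded sets, which are the Euclidean
   ones.  Every quantitative notion below uses the Euclidean norm enorm. *)
Definition dotv (R : realType) (d : nat) (u v : 'rV[R]_d) : R :=
  \sum_(i < d) u 0 i * v 0 i.

Definition enorm (R : realType) (d : nat) (u : 'rV[R]_d) : R :=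
  Num.sqrt (dotv u u).

(* The infimum of the empty set is +oo in \bar R, so dist_to_set x set0 = +oo. *)
Definition dist_to_set (R : realType) (d : nat) (x : 'rV[R]_d) (S : set 'rV[R]_d) :
    \bar R :=
  ereal_inf [set (enorm (x - v))%:E | v in S].

Definition gradient (R : realType) (d : nat) (F : 'rV[R]_d -> R)
    (z : 'rV[R]_d) : 'rV[R]_d :=
  \row_(i < d) 'D_(delta_mx 0 i) F z.

Definition C1_smooth (R : realType) (d : nat) (F : 'rV[R]_d -> R) : Prop :=
  (forall z, differentiable F z) /\ continuous (gradient F).

Definition gradient_lipschitz_on_bounded (R : realType) (d : nat)
    (F : 'rV[R]_d -> R) : Prop :=
  forall B : set 'rV[R]_d, bounded_set B ->
    exists K : R, forall z w, B z -> B w ->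
      enorm (gradient F z - gradient F w) <= K * enorm (z - w).

(* Functions with values in R \cup {oo} are functions to \bar R that never
   take the value -oo; this is the first conjunct. *)
Definition proper_fun (R : realType) (d : nat) (h : 'rV[R]_d -> \bar R) :
    Prop :=
  (forall x, h x != -oo%E) /\ (exists x, h x \is a fin_num).

Definition effective_dom (R : realType) (d : nat) (h : 'rV[R]_d -> \bar R) :
    set 'rV[R]_d :=
  [set x | (h x < +oo)%E].

Definition frechet_subdiff (R : realType) (d : nat) (h : 'rV[R]_d -> \bar R)
    (x : 'rV[R]_d) : set 'rV[R]_d :=
  [set v | effective_dom h x /\
    (0 <= limf_einf
      (fun u => (h u - h x - (dotv v (u - x))%:E) * ((enorm (u - x))^-1)%:E)
      x^')%E].

Definition limiting_subdiff (R : realType) (d : nat) (h : 'rV[R]_d -> \bar R)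
    (x : 'rV[R]_d) : set 'rV[R]_d :=
  [set v | effective_dom h x /\
    exists xs vs : nat -> 'rV[R]_d,
      [/\ xs @ \oo --> x,
          (fun k => h (xs k)) @ \oo --> h x,
          forall k, frechet_subdiff h (xs k) (vs k)
        & vs @ \oo --> v]].

Definition M_stationary (R : realType) (d : nat) (h : 'rV[R]_d -> \bar R)
    (x : 'rV[R]_d) : Prop :=
  limiting_subdiff h x 0.

(* On the points x considered, h xbar and h x are both finite, so that fine is
   applied to a real number. *)
Definition exponent_PLK (R : realType) (d : nat) (h : 'rV[R]_d -> \bar R)
    (xbar : 'rV[R]_d) (M q : R) : Prop :=
  let phi := fun t : R => M * t `^ (1 - q) in
  effective_dom h xbar /\
  exists2 eta : R, 0 < eta &
    \forall x \near nbhs xbar,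
      (h xbar < h x)%E -> (h x < h xbar + eta%:E)%E ->
      (1 <= (derive1 phi (fine (h x - h xbar)))%:E
            * dist_to_set 0 (limiting_subdiff h x))%E.

Definition argmin (R : realType) (d : nat) (F : 'rV[R]_d -> \bar R) :
    set 'rV[R]_d :=
  [set u | forall w, (F u <= F w)%E].

Definition objective (R : realType) (n m : nat) (f : 'rV[R]_n -> \bar R)
    (Q : 'rV[R]_(n + m) -> R) (g : 'rV[R]_m -> \bar R)
    (z : 'rV[R]_(n + m)) : \bar R :=
  (f (lsubmx z) + (Q z)%:E + g (rsubmx z))%E.

Definition assumption_H (R : realType) (n m : nat) (f : 'rV[R]_n -> \bar R)
    (Q : 'rV[R]_(n + m) -> R) (g : 'rV[R]_m -> \bar R) : Prop :=
  [/\ proper_fun f /\ lower_semicontinuous f,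
      proper_fun g /\ lower_semicontinuous g,
      C1_smooth Q
    & gradient_lipschitz_on_bounded Q].

Definition assumption_H1 (R : realType) (n m : nat)
    (L : 'rV[R]_(n + m) -> \bar R) (y0 : 'rV[R]_m) (lam mu : nat -> R) :
    Prop :=
  [/\ (-oo < ereal_inf (range L))%E,
      proper_fun (fun x : 'rV[R]_n => L (row_mx x y0))
    & exists rm rp : R,
        [/\ 0 < rm, rm < rp
          & forall k, (rm < lam k < rp) && (rm < mu k < rp)]].

Definition alternating_minimization (R : realType) (n m : nat)
    (L : 'rV[R]_(n + m) -> \bar R) (x0 : 'rV[R]_n) (y0 : 'rV[R]_m)
    (lam mu : nat -> R) (x : nat -> 'rV[R]_n) (y : nat -> 'rV[R]_m) : Prop :=
  [/\ x 0%N = x0,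
      y 0%N = y0
    & forall k,
        argmin (fun u => L (row_mx u (y k))
                  + ((2 * lam k)^-1 * enorm (u - x k) ^+ 2)%:E)%E (x k.+1) /\
        argmin (fun v => L (row_mx (x k.+1) v)
                  + ((2 * mu k)^-1 * enorm (v - y k) ^+ 2)%:E)%E (y k.+1)].

Definition finite_termination (R : realType) (d : nat) (z : nat -> 'rV[R]_d)
    (zs : 'rV[R]_d) : Prop :=
  \forall k \near \oo, z k = zs.

Definition superlinear_convergence (R : realType) (d : nat)
    (z : nat -> 'rV[R]_d) (zs : 'rV[R]_d) : Prop :=
  (fun k => enorm (z k.+1 - zs) / enorm (z k - zs)) @ \oo --> (0 : R).

(* Iterates are numbered from 0; rates are asserted for k >= 1. *)
Definition linear_convergence (R : realType) (d : nat)
    (z : nat -> 'rV[R]_d) (zs : 'rV[R]_d) : Prop :=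
  exists c tau : R, [/\ 0 < c, 0 <= tau < 1
    & forall k : nat, (0 < k)%N -> enorm (z k - zs) <= c * tau ^+ k].

(* Main.v *)
(* The value gaps s_k = L(z_k) - L(z_star) and the steps d_k = |z_{k+1} - z_k|
   satisfy, from some rank on, the sufficient decrease
   a d_k^2 <= s_k - s_{k+1} and, since both argmin conditions provide a
   Frechet subgradient of L at z_{k+1} of norm O(d_k), the PLK inequality
   s_{k+1}^q <= A d_k.  If some s_k vanishes, the iterates stop; otherwise
   q = 0 contradicts d_k -> 0.  For q < 1/2 one gets
   (d_{k+1} / d_k)^2 <= C s_{k+1}^(1 - 2q) -> 0.  For q >= 1/2, concavity of
   t^(1 - q) yields d_k <= V_k - V_{k+1} with
   V_{k+1} = d_k + B s_{k+1}^(1 - q), so that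
   |z_k - z_star| <= V_k = O(s_{k-1}^(1 - q)); here s_k decays geometrically if
   q = 1/2, and s_k^(1 - 2q) grows at least linearly if q > 1/2. *)
Require Import Defs.
From HB Require Import structures.
From mathcomp Require Import all_boot all_order all_algebra.
From mathcomp Require Import all_classical all_reals all_analysis.
From mathcomp Require Import ring lra.

Set Implicit Arguments.
Unset Strict Implicit.
Unset Printing Implicit Defensive.

Import Order.TTheory GRing.Theory Num.Theory.
Import numFieldNormedType.Exports.

Local Open Scope classical_set_scope.
Local Open Scope ring_scope.

(** * Euclidean inner product and norm *)

Lemma dotvC (R : realType) d (u v : 'rV[R]_d) : dotv u v = dotv v u.
Proof. by apply: eq_bigr => i _; rewrite mulrC. Qed.

Lemma dotvDl (R : realType) d (u v w : 'rV[R]_d) :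
  dotv (u + v) w = dotv u w + dotv v w.
Proof. by rewrite -big_split; apply: eq_bigr => i _; rewrite mxE mulrDl. Qed.

Lemma dotvZl (R : realType) d (a : R) (u v : 'rV[R]_d) :
  dotv (a *: u) v = a * dotv u v.
Proof. by rewrite /dotv mulr_sumr; apply: eq_bigr => i _; rewrite mxE mulrA. Qed.

Lemma dotvNl (R : realType) d (u v : 'rV[R]_d) : dotv (- u) v = - dotv u v.
Proof. by rewrite -scaleN1r dotvZl mulN1r. Qed.

Lemma dotvDr (R : realType) d (u v w : 'rV[R]_d) :
  dotv w (u + v) = dotv w u + dotv w v.
Proof. by rewrite ![dotv w _]dotvC dotvDl. Qed.

Lemma dotvNr (R : realType) d (u v : 'rV[R]_d) : dotv u (- v) = - dotv u v.
Proof. by rewrite dotvC dotvNl dotvC. Qed.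

Lemma dotvZr (R : realType) d (a : R) (u v : 'rV[R]_d) :
  dotv u (a *: v) = a * dotv u v.
Proof. by rewrite dotvC dotvZl dotvC. Qed.

Lemma dotv_ge0 (R : realType) d (u : 'rV[R]_d) : 0 <= dotv u u.
Proof. by apply: sumr_ge0 => i _; rewrite -expr2 sqr_ge0. Qed.

Lemma enorm_ge0 (R : realType) d (u : 'rV[R]_d) : 0 <= enorm u.
Proof. exact: sqrtr_ge0. Qed.

Lemma sqr_enorm (R : realType) d (u : 'rV[R]_d) : enorm u ^+ 2 = dotv u u.
Proof. by rewrite sqr_sqrtr ?dotv_ge0. Qed.

Lemma dotv_eq0 (R : realType) d (u : 'rV[R]_d) : dotv u u = 0 -> u = 0.
Proof.
move=> u0; apply/rowP => i; rewrite mxE; apply/eqP; rewrite -sqrf_eq0 expr2.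
by move/psumr_eq0P: u0 => ->// j _; rewrite -expr2 sqr_ge0.
Qed.

Lemma enorm_eq0 (R : realType) d (u : 'rV[R]_d) : enorm u = 0 -> u = 0.
Proof. by move=> u0; apply: dotv_eq0; rewrite -sqr_enorm u0 expr0n. Qed.

Lemma enorm0 (R : realType) d : enorm (0 : 'rV[R]_d) = 0.
Proof.
by rewrite /enorm /dotv big1 ?sqrtr0// => i _; rewrite mxE mul0r.
Qed.

Lemma enormN (R : realType) d (u : 'rV[R]_d) : enorm (- u) = enorm u.
Proof. by rewrite /enorm dotvNl dotvNr opprK. Qed.

Lemma enorm_distC (R : realType) d (u v : 'rV[R]_d) :
  enorm (u - v) = enorm (v - u).
Proof. by rewrite -enormN opprB. Qed.

(** Cauchy-Schwarz: for nonzero u and v, the squared norm of |v| u - |u| v equals 2 |u| |v| (|u| |v|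
    - <u, v>). *)
Lemma dotv_le_enorm (R : realType) d (u v : 'rV[R]_d) :
  dotv u v <= enorm u * enorm v.
Proof.
have [u0|uN0] := eqVneq (enorm u) 0.
  by rewrite u0 (enorm_eq0 u0) -(scale0r 0) dotvZl !mul0r.
have [v0|vN0] := eqVneq (enorm v) 0.
  by rewrite v0 (enorm_eq0 v0) -(scale0r 0) dotvZr mul0r mulr0.
have p0 : 0 < enorm u * enorm v.
  by rewrite mulr_gt0// lt_def ?uN0 ?vN0 enorm_ge0.
have := dotv_ge0 (enorm v *: u - enorm u *: v).
rewrite dotvDl !dotvDr !dotvNl !dotvNr !dotvZl !dotvZr -!sqr_enorm (dotvC v u).
rewrite (_ : _ + _ = 2 * (enorm u * enorm v) * (enorm u * enorm v - dotv u v));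
  last by ring.
by rewrite pmulr_rge0 ?subr_ge0// mulr_gt0.
Qed.

Lemma ler_enormD (R : realType) d (u v : 'rV[R]_d) :
  enorm (u + v) <= enorm u + enorm v.
Proof.
rewrite -(@ler_pXn2r _ 2)// ?nnegrE ?addr_ge0 ?enorm_ge0// sqr_enorm.
rewrite dotvDl !dotvDr -!sqr_enorm (dotvC v u).
have := dotv_le_enorm u v; lra.
Qed.

Lemma ler_enorm_distD (R : realType) d (w u v : 'rV[R]_d) :
  enorm (u - v) <= enorm (u - w) + enorm (w - v).
Proof. by rewrite -[u - v](subrKA w) ler_enormD. Qed.

Lemma enormZ (R : realType) d (a : R) (u : 'rV[R]_d) :
  enorm (a *: u) = `|a| * enorm u.
Proof.
by rewrite /enorm dotvZl dotvZr mulrA -expr2 sqrtrM ?sqr_ge0// sqrtr_sqr.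
Qed.

Lemma sqr_enorm_row_mx (R : realType) n m (u : 'rV[R]_n) (v : 'rV[R]_m) :
  enorm (row_mx u v) ^+ 2 = enorm u ^+ 2 + enorm v ^+ 2.
Proof.
rewrite !sqr_enorm /dotv big_split_ord /=.
by congr (_ + _); apply: eq_bigr => i _; rewrite ?row_mxEl ?row_mxEr.
Qed.

Lemma enorm_row_mx_ge (R : realType) n m (u : 'rV[R]_n) (v : 'rV[R]_m) :
  (enorm u <= enorm (row_mx u v)) * (enorm v <= enorm (row_mx u v)).
Proof.
split; rewrite -(@ler_pXn2r _ 2)// ?nnegrE ?enorm_ge0// sqr_enorm_row_mx;
  by rewrite ?lerDl ?lerDr sqr_ge0.
Qed.

Lemma enorm_row_mx_le (R : realType) n m (u : 'rV[R]_n) (v : 'rV[R]_m) :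
  enorm (row_mx u v) <= enorm u + enorm v.
Proof.
rewrite -(@ler_pXn2r _ 2)// ?nnegrE ?addr_ge0 ?enorm_ge0// sqr_enorm_row_mx.
by rewrite sqrrD addrAC lerDl mulrn_wge0// mulr_ge0 ?enorm_ge0.
Qed.

(** * Comparison with the sup norm and its neighborhoods *)

Lemma coord_le_norm (R : realType) d (u : 'rV[R]_d) i : `|u 0 i| <= `|u|.
Proof.
have /mapP[k _ ->] : `|u 0 i| \in [seq `|u 0 j| | j <- enum 'I_d].
  by apply/mapP; exists i; rewrite ?mem_enum.
rewrite /Num.norm/= mx_normrE.
by apply/bigmax_geP; right; exists (0, k).
Qed.

Lemma normv_le_enorm (R : realType) d (u : 'rV[R]_d) : `|u| <= enorm u.
Proof.
rewrite /Num.norm/= mx_normrE; apply: bigmax_le => [|[i j] _ /=].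
  exact: enorm_ge0.
rewrite (ord1 i) -sqrtr_sqr ler_wsqrtr// /dotv (bigD1 j)//= expr2 lerDl.
by apply: sumr_ge0 => k _; rewrite -expr2 sqr_ge0.
Qed.

Lemma enorm_le_normv (R : realType) d (u : 'rV[R]_d) :
  enorm u <= d%:R * `|u|.
Proof.
rewrite -(@ler_pXn2r _ 2)// ?nnegrE ?mulr_ge0 ?enorm_ge0// sqr_enorm /dotv.
apply: (@le_trans _ _ (\sum_(i < d) `|u| ^+ 2)).
  apply: ler_sum => i _; rewrite -expr2 -real_normK ?num_real//.
  by rewrite lerXn2r ?nnegrE// coord_le_norm.
rewrite sumr_const card_ord -[leLHS]mulr_natl exprMn ler_wpM2r ?sqr_ge0//.
by rewrite -natrX ler_nat; case: d u => // d _; rewrite leq_pmulr.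
Qed.

Lemma near_enorm_lt (R : realType) d (z : 'rV[R]_d) (e : R) : 0 < e ->
  \forall u \near z, enorm (u - z) < e.
Proof.
move=> e0; near=> u; apply: le_lt_trans (enorm_le_normv _) _.
(* In dimension 0 the factor d vanishes, whereas d + 1 can always be divided by. *)
have d0 : 0 < d%:R + 1 :> R by rewrite ltr_wpDl.
apply: (@le_lt_trans _ _ ((d%:R + 1) * `|u - z|)).
  by rewrite ler_wpM2r// lerDl.
rewrite -ltr_pdivlMl// distrC; near: u.
by apply: (@cvgr_dist_lt _ _ _ _ _ id z) => //; rewrite mulr_gt0 ?invr_gt0.
Unshelve. all: end_near. Qed.

Lemma enorm_lt_near (R : realType) d (z : 'rV[R]_d) (P : set 'rV[R]_d) :
  (\forall u \near z, P u) ->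
  exists2 e : R, 0 < e & forall u, enorm (u - z) < e -> P u.
Proof.
move=> /nbhs_ballP[e /= e0 eP]; exists e => // u uz; apply: eP.
by rewrite -ball_normE /= distrC (le_lt_trans (normv_le_enorm _)).
Qed.

(** * Inequalities for real powers *)

(** The graph of the concave t^r lies below its tangent at 1: this is Young's inequality for the
    product of t^r and 1 with exponents 1 / r and 1 / (1 - r). *)
Lemma powR_le_tangent (R : realType) (t r : R) : 0 <= t -> 0 < r < 1 ->
  t `^ r <= 1 + r * (t - 1).
Proof.
move=> t0 /andP[r0 r1]; have r1' : 0 < 1 - r by rewrite subr_gt0.
have := @conjugate_powR _ (t `^ r) 1 r^-1 (1 - r)^-1 (powR_ge0 _ _) ler01.
rewrite !invr_gt0 !invrK -powRrM mulfV ?gt_eqF// powRr1// powR1.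
by move=> /(_ r0 r1' ltac:(by rewrite addrC subrK)); lra.
Qed.

(** The tangent inequality at v / u, multiplied by u^r. *)
Lemma powR_increment_ge (R : realType) (u v r : R) : 0 < u -> 0 <= v ->
  0 < r < 1 -> r * u `^ (r - 1) * (u - v) <= u `^ r - v `^ r.
Proof.
move=> u0 v0 r01; have := powR_le_tangent (divr_ge0 v0 (ltW u0)) r01.
rewrite -(ler_pM2r (powR_gt0 r u0)) -powRM ?divr_ge0 ?(ltW u0)//.
rewrite divfK ?gt_eqF// powRB ?(gt_eqF u0) ?implybT// powRr1 ?(ltW u0)//.
have -> : (1 + r * (v / u - 1)) * u `^ r =
  u `^ r - r * (u `^ r / u) * (u - v) by field; rewrite gt_eqF.
by lra.
Qed.

(** * From bounds on the steps to bounds on the error *)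

Lemma enorm_cvg_lt (R : realType) d (z : nat -> 'rV[R]_d) (zs : 'rV[R]_d) :
  z @ \oo --> zs -> forall e, 0 < e ->
  \forall k \near \oo, enorm (z k - zs) < e.
Proof. by move=> zzs e /(near_enorm_lt zs); apply: zzs. Qed.

(** Summing gives |z_{k+j} - z_k| <= V_k - V_{k+j} <= V_k; then j goes to infinity. *)
Lemma enorm_le_telescope (R : realType) d (z : nat -> 'rV[R]_d)
    (zs : 'rV[R]_d) (V : nat -> R) (K : nat) :
  z @ \oo --> zs -> (forall k, (K <= k)%N -> 0 <= V k) ->
  (forall k, (K <= k)%N -> enorm (z k.+1 - z k) <= V k - V k.+1) ->
  forall k, (K <= k)%N -> enorm (z k - zs) <= V k.
Proof.
move=> zzs V0 dV k Kk.
have tele j : enorm (z (k + j)%N - z k) <= V k - V (k + j)%N.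
  elim: j => [|j IH]; first by rewrite addn0 !subrr enorm0.
  rewrite addnS; apply: le_trans (ler_enorm_distD (z (k + j)%N) _ _) _.
  have := dV _ (leq_trans Kk (leq_addr j k)); lra.
suff le_e (e : R) : 0 < e -> enorm (z k - zs) <= V k + e by exact/ler_addgt0Pr.
move=> e0.
have [N _ Nz] := enorm_cvg_lt zzs e0.
have := Nz (k + N)%N (leq_addl _ _); have := tele N.
have := V0 _ (leq_trans Kk (leq_addr N k)).
have := ler_enorm_distD (z (k + N)%N) (z k) zs.
rewrite (enorm_distC (z k) (z _)); lra.
Qed.

(** The finitely many early ratios e_i / b_i are absorbed into the constant, so a rate proved from
    some rank on holds for all k >= 1. *)
Lemma eventually_le_scale (R : realType) (e b : nat -> R) :
  (forall k, (0 < k)%N -> 0 < b k) -> (\forall k \near \oo, e k <= b k) ->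
  exists2 c : R, 0 < c & forall k, (0 < k)%N -> e k <= c * b k.
Proof.
move=> b0 [N _ eb].
exists (1 + \sum_(i < N) `|e i / b i|) => [|k k0].
  by rewrite ltr_wpDr// sumr_ge0.
have [kN|Nk] := ltnP k N; last first.
  apply: (le_trans (eb _ Nk)); rewrite ler_peMl ?(ltW (b0 _ k0))//.
  by rewrite lerDl sumr_ge0.
rewrite -ler_pdivrMr ?b0//; apply: le_trans (ler_norm _) _.
rewrite (bigD1 (Ordinal kN))//= addrCA lerDl addr_ge0//.
by rewrite sumr_ge0.
Qed.

Lemma finite_termination_linear (R : realType) d (z : nat -> 'rV[R]_d) zs :
  finite_termination z zs -> linear_convergence z zs.
Proof.
move=> zzs.
have h0 : 0 < 2^-1 :> R by rewrite invr_gt0.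
have [k _||c c0 cz] := @eventually_le_scale _ (fun k => enorm (z k - zs))
  (fun k => 2^-1 ^+ k).
- by rewrite exprn_gt0.
- by apply: filterS zzs => k ->; rewrite subrr enorm0 exprn_ge0// ltW.
by exists c, 2^-1; split => //; rewrite ltW//= invf_lt1// ltr1n.
Qed.

Lemma finite_termination_polynomial (R : realType) d (z : nat -> 'rV[R]_d) zs
    (r : R) : finite_termination z zs ->
  exists2 c : R, 0 < c &
    forall k, (0 < k)%N -> enorm (z k - zs) <= c * k%:R `^ r.
Proof.
move=> zzs; apply: eventually_le_scale => [k k0|].
  by rewrite powR_gt0// ltr0n.
by apply: filterS zzs => k ->; rewrite subrr enorm0 powR_ge0.
Qed.

(** * Rates from sufficient decrease and the PLK inequality *)

Lemma cvg0_norm_lt (R : realType) (s : nat -> R) (e : R) :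
  s @ \oo --> 0 -> 0 < e -> exists N, forall k, (N <= k)%N -> `|s k| < e.
Proof. by move=> s0 e0; have [N _ sN] := cvgr0_norm_lt s s0 _ e0; exists N. Qed.

(** The case q = 0: each step lowers the value by more than a / (1 + A^2), which exceeds what is
    left once s_k is small. *)
Lemma no_sharp_descent (R : realType) (s D : nat -> R) (a A : R) (K : nat) :
  0 < a -> s @ \oo --> 0 -> (forall k, (K <= k)%N -> 0 <= s k) ->
  (forall k, (K <= k)%N -> a * D k ^+ 2 <= s k - s k.+1) ->
  (forall k, (K <= k)%N -> 1 <= A * D k) -> False.
Proof.
move=> a0 s0 sge desc plk.
have A0 : 0 < 1 + A ^+ 2 by rewrite ltr_wpDr ?sqr_ge0.
have [N sN] := cvg0_norm_lt s0 (divr_gt0 a0 A0).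
have Kk : (K <= K + N)%N := leq_addr N K.
have := sN _ (leq_addl K N); have := plk _ Kk; have := desc _ Kk.
have := sge _ (leqW Kk).
move: (s (K + N)%N) (s (K + N).+1) (D (K + N)%N) => u v w v0 auv Aw.
rewrite ger0_norm; last by have := sqr_ge0 w; nra.
rewrite ltr_pdivlMr// => h.
have : 1 <= (A * w) ^+ 2 by rewrite exprn_ege1.
have := sqr_ge0 w; have := sqr_ge0 A; have : a * w ^+ 2 <= u by lra.
move: h; rewrite exprMn; move: (w ^+ 2) (A ^+ 2) => W B h aWu B0 W0 BW.
have : a * W * (1 + B) <= u * (1 + B) by apply: ler_wpM2r => //; lra.
nra.
Qed.
(* Concavity of t `^ (1 - q) gives d' ^+ 2 <= d * (B * decrement), and AM-GM
   splits the product. *)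
Lemma PLK_step_le (R : realType) (a A q s s' d d' : R) :
  0 < a -> 0 < A -> 0 < q < 1 -> 0 < s -> 0 < s' -> 0 <= d -> 0 <= d' ->
  s `^ q <= A * d -> a * d' ^+ 2 <= s - s' ->
  2 * d' <= d + A / (a * (1 - q)) * (s `^ (1 - q) - s' `^ (1 - q)).
Proof.
move=> a0 A0 /andP[q0 q1] s0 s'0 d0 d'0 sd desc.
have q1' : 0 < 1 - q by rewrite subr_gt0.
have := @powR_increment_ge _ s s' (1 - q) s0 (ltW s'0).
rewrite q1' ltrBlDr ltrDl q0 => /(_ isT).
rewrite (_ : 1 - q - 1 = - q); last by ring.
rewrite powRN; move: (s `^ (1 - q) - _) => P.
have sq0 := powR_gt0 q s0; move: (s `^ q) sd sq0 => t td t0 hP.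
have hP' : (1 - q) * (s - s') <= A * d * P.
  have P0 : 0 <= P.
    apply: le_trans hP; rewrite mulr_ge0//; first by rewrite mulr_ge0 ?invr_ge0 ?ltW.
    by apply: le_trans desc; rewrite mulr_ge0 ?sqr_ge0// ltW.
  apply: (@le_trans _ _ (t * P)); last exact: ler_wpM2r.
  rewrite -ler_pdivrMl//; apply: le_trans hP.
  by rewrite mulrA [t^-1 * _]mulrC.
have h : d' ^+ 2 <= d * (A / (a * (1 - q)) * P).
  rewrite -(ler_pM2l (mulr_gt0 a0 q1')).
  rewrite (_ : _ * (d * _) = A * d * P); last by field; rewrite !gt_eqF.
  apply: le_trans hP'; rewrite (mulrC a) -mulrA.
  by rewrite ler_pM2l.
move: (A / _ * P) h => B h.
have [|dB] := leP 0 (d + B); last by have := sqr_ge0 d'; have := sqr_ge0 d; nra.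
move=> dB; rewrite -(@ler_pXn2r _ 2)// ?nnegrE ?mulr_ge0//.
have := sqr_ge0 (d - B); rewrite !expr2; rewrite expr2 in h; nra.
Qed.

Lemma enorm_le_potential (R : realType) d (z : nat -> 'rV[R]_d) (zs : 'rV[R]_d)
    (s : nat -> R) (a A q : R) (K : nat) :
  z @ \oo --> zs -> 0 < a -> 0 < A -> 0 < q < 1 ->
  (forall k, (K <= k)%N -> 0 < s k) ->
  (forall k, (K <= k)%N -> a * enorm (z k.+1 - z k) ^+ 2 <= s k - s k.+1) ->
  (forall k, (K <= k)%N -> s k.+1 `^ q <= A * enorm (z k.+1 - z k)) ->
  forall k, (K <= k)%N -> enorm (z k.+1 - zs) <=
    enorm (z k.+1 - z k) + A / (a * (1 - q)) * s k.+1 `^ (1 - q).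
Proof.
move=> zzs a0 A0 q01 s0 desc plk k Kk; have /andP[_ q1] := q01.
(* With this potential, [PLK_step_le] says exactly that |z_{j+1} - z_j| <= V_j - V_{j+1}. Only j > K
   occurs, so [j.-1] is a true predecessor. *)
pose V j := enorm (z j - z j.-1) + A / (a * (1 - q)) * s j `^ (1 - q).
apply: (@enorm_le_telescope _ _ _ _ V K.+1) => // -[//|j]; rewrite ltnS => Kj.
  rewrite addr_ge0 ?enorm_ge0// mulr_ge0 ?powR_ge0//.
  by rewrite divr_ge0 ?mulr_ge0 ?subr_ge0// ltW.
have := PLK_step_le a0 A0 q01 (s0 _ (leqW Kj)) (s0 _ (leqW (leqW Kj)))
  (enorm_ge0 _) (enorm_ge0 _) (plk _ Kj) (desc _ (leqW Kj)).
rewrite /V /=; lra.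
Qed.

(** Removes the step from the potential bound: sufficient decrease gives |z_{k+1} - z_k| <= (s_k /
    a)^(1/2), and s_k^(1/2) <= s_k^(1 - q) because s_k <= 1 and 1 - q <= 1/2. *)
Lemma enorm_le_value (R : realType) d (z : nat -> 'rV[R]_d) (zs : 'rV[R]_d)
    (s : nat -> R) (a A q : R) (K : nat) :
  z @ \oo --> zs -> 0 < a -> 0 < A -> 2^-1 <= q < 1 ->
  (forall k, (K <= k)%N -> 0 < s k <= 1) ->
  (forall k, (K <= k)%N -> a * enorm (z k.+1 - z k) ^+ 2 <= s k - s k.+1) ->
  (forall k, (K <= k)%N -> s k.+1 `^ q <= A * enorm (z k.+1 - z k)) ->
  exists2 C : R, 0 < C & forall k, (K <= k)%N ->
    enorm (z k.+1 - zs) <= C * s k `^ (1 - q).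
Proof.
move=> zzs a0 A0 /andP[q2 q1] s01 desc plk.
have q0 : 0 < q by apply: lt_le_trans q2; rewrite invr_gt0.
have B0 : 0 < A / (a * (1 - q)) by rewrite divr_gt0// mulr_gt0// subr_gt0.
exists (Num.sqrt a^-1 + A / (a * (1 - q))).
  by rewrite ltr_wpDl// sqrtr_ge0.
move=> k Kk; have /andP[s0 s1] := s01 _ Kk.
have /andP[s0' _] := s01 _ (leqW Kk).
apply: le_trans (enorm_le_potential zzs a0 A0 _ _ desc plk Kk) _.
- by rewrite q0.
- by move=> j /s01/andP[].
have := desc _ Kk; have := sqr_ge0 (enorm (z k.+1 - z k)) => dge de.
have ss' : s k.+1 <= s k.
  by rewrite -subr_ge0 (le_trans _ de)// mulr_ge0// ltW.
rewrite mulrDl lerD//; last first.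
  rewrite ler_pM2l//; apply: ge0_ler_powR; rewrite ?nnegrE ?(ltW s0) ?(ltW s0')//.
  by rewrite subr_ge0 ltW.
apply: (@le_trans _ _ (Num.sqrt a^-1 * s k `^ 2^-1)); last first.
  rewrite ler_wpM2l ?sqrtr_ge0//; apply: ger_powR; first by rewrite s0.
  lra.
rewrite powR12_sqrt ?(ltW s0)// -sqrtrM ?invr_ge0 ?(ltW a0)//.
rewrite -[leLHS]ger0_norm ?enorm_ge0// -sqrtr_sqr ler_wsqrtr//.
by rewrite ler_pdivlMl//; apply: le_trans de _; rewrite lerBlDr lerDl ltW.
Qed.

(** Once the steps d_k shrink by a factor t / 4, the error e_{k+1} is at most 2 d_{k+1} <= (t / 2)
    d_k <= (t / 2) (e_k + e_{k+1}), whence e_{k+1} <= t e_k for t <= 1/2. *)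
Lemma superlinear_of_steps (R : realType) d (z : nat -> 'rV[R]_d)
    (zs : 'rV[R]_d) : z @ \oo --> zs ->
  (forall t : R, 0 < t -> exists N, forall k, (N <= k)%N ->
     enorm (z k.+2 - z k.+1) <= t * enorm (z k.+1 - z k)) ->
  superlinear_convergence z zs.
Proof.
move=> zzs steps.
have ratio t : 0 < t <= 2^-1 -> exists N, forall k, (N <= k)%N ->
    enorm (z k.+1 - zs) / enorm (z k - zs) <= t.
  move=> /andP[t0 t2].
  have t4 : 0 < t / 4 by rewrite divr_gt0.
  have [N zN] := steps _ t4; exists N => k Nk.
  have tail j : (N <= j)%N ->
      enorm (z j.+1 - zs) <= 2 * enorm (z j.+2 - z j.+1).
    move=> Nj.
    apply: (@enorm_le_telescope _ _ z zs (fun i => 2 * enorm (z i.+1 - z i)) N)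
      => //; last exact: leqW.
      by move=> i _; rewrite mulr_ge0 ?enorm_ge0.
    by move=> i /zN; have := enorm_ge0 (z i.+1 - z i); nra.
  have := tail _ Nk; have := zN _ Nk.
  have := enorm_ge0 (z k.+1 - z k); have := enorm_ge0 (z k.+1 - zs).
  have := ler_enorm_distD zs (z k.+1) (z k); rewrite (enorm_distC zs).
  move: (enorm (z k.+1 - zs)) (enorm (z k.+2 - z k.+1)).
  move: (enorm (z k.+1 - z k)) => d0 e1 d1 d0e e10 d00 d1d e1d.
  (* If z_k is already the limit, the quotient is 0 because the inverse of 0 is 0. *)
  have := enorm_ge0 (z k - zs); rewrite le_eqVlt => /predU1P[<-|e0].
    by rewrite invr0 mulr0 ltW.
  rewrite ler_pdivrMr//; nra.
apply/cvgr0Pnorm_le => e e0.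
have := @ratio (Num.min e 2^-1).
rewrite lt_min e0 invr_gt0 ltr0n /= ge_min lexx orbT => /(_ isT) [N zN].
exists N => // k /= /zN; rewrite le_min => /andP[ke _].
by rewrite ger0_norm// divr_ge0 ?enorm_ge0.
Qed.

Lemma PLK_superlinear (R : realType) d (z : nat -> 'rV[R]_d) (zs : 'rV[R]_d)
    (s : nat -> R) (a A q : R) (K : nat) :
  z @ \oo --> zs -> s @ \oo --> 0 -> 0 < a -> 0 < A -> 0 < q < 2^-1 ->
  (forall k, (K <= k)%N -> 0 < s k) ->
  (forall k, (K <= k)%N -> a * enorm (z k.+1 - z k) ^+ 2 <= s k - s k.+1) ->
  (forall k, (K <= k)%N -> s k.+1 `^ q <= A * enorm (z k.+1 - z k)) ->
  superlinear_convergence z zs.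
Proof.
move=> zzs ss a0 A0 /andP[q0 q2] s0 desc plk.
apply: superlinear_of_steps => // t t0.
have p0 : 0 < 1 - 2 * q by lra.
(* Threshold for s_{k+1}^(1 - 2q): multiplied by A^2 / a it becomes t^2, the required squared ratio
   of steps. *)
have c0 : 0 < t ^+ 2 * a / A ^+ 2 by rewrite divr_gt0 ?exprn_gt0// mulr_gt0 ?exprn_gt0.
have [N sN] := cvg0_norm_lt ss (powR_gt0 (1 - 2 * q)^-1 c0).
exists (K + N)%N => k KNk.
have Kk := leq_trans (leq_addr _ _) KNk; have Nk := leq_trans (leq_addl _ _) KNk.
rewrite -(@ler_pXn2r _ 2)// ?nnegrE ?enorm_ge0 ?(mulr_ge0 (ltW t0)) ?enorm_ge0//.
have := sN _ (leqW Nk); have := desc _ (leqW Kk); have := plk _ Kk.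
have := s0 _ (leqW Kk); have := s0 _ (leqW (leqW Kk)).
move: (s k.+1) (s k.+2) (enorm (z k.+2 - _)) (enorm_ge0 (z k.+1 - z k)).
move: (enorm (z k.+1 - z k)) => D u v D' D0 v0 u0 uD desc'.
rewrite gtr0_norm// => /ltW ult.
have up : u `^ (1 - 2 * q) <= t ^+ 2 * a / A ^+ 2.
  rewrite -[leRHS]powRr1 ?(ltW c0)// -[X in _ <= _ `^ X](mulVf (lt0r_neq0 p0)) powRrM.
  by apply: ge0_ler_powR; rewrite ?nnegrE ?powR_ge0// ltW.
(* The factor (u^q)^2 is bounded by the PLK inequality; the other one is small since 1 - 2q > 0. *)
have u2 : u = u `^ (1 - 2 * q) * (u `^ q) ^+ 2.
  rewrite -powR_mulrn ?powR_ge0// -powRrM mulrC (mulrC q) -powRD; last first.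
    by rewrite (gt_eqF u0) implybT.
  by rewrite addrC subrK powRr1// ltW.
rewrite exprMn -(ler_pM2l a0); apply: (le_trans desc').
apply: (@le_trans _ _ u); first by rewrite lerBlDr lerDl ltW.
rewrite u2; apply: (@le_trans _ _ (t ^+ 2 * a / A ^+ 2 * (A * D) ^+ 2)).
  apply: ler_pM => //; rewrite ?powR_ge0 ?sqr_ge0//.
  by rewrite lerXn2r ?nnegrE ?powR_ge0// mulr_ge0// ltW.
by rewrite le_eqVlt; apply/orP; left; apply/eqP; field; rewrite gt_eqF.
Qed.

Lemma PLK_linear (R : realType) d (z : nat -> 'rV[R]_d) (zs : 'rV[R]_d)
    (s : nat -> R) (a A : R) (K : nat) :
  z @ \oo --> zs -> 0 < a -> 0 < A ->
  (forall k, (K <= k)%N -> 0 < s k <= 1) ->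
  (forall k, (K <= k)%N -> a * enorm (z k.+1 - z k) ^+ 2 <= s k - s k.+1) ->
  (forall k, (K <= k)%N -> s k.+1 `^ 2^-1 <= A * enorm (z k.+1 - z k)) ->
  linear_convergence z zs.
Proof.
move=> zzs a0 A0 s01 desc plk.
have [|C C0 Cs] := enorm_le_value zzs a0 A0 _ s01 desc plk.
  by rewrite lexx invf_lt1// ltr1n.
(* Squaring the PLK inequality and inserting the decrease gives s_{k+1} <= c (s_k - s_{k+1}), that
   is, contraction by rho = c / (1 + c). *)
pose c := A ^+ 2 / a; have c0 : 0 < c by rewrite divr_gt0 ?exprn_gt0.
pose rho := c / (1 + c).
have rho01 : 0 < rho < 1 by rewrite divr_gt0 ?addr_gt0//= ltr_pdivrMr ?addr_gt0//; lra.
have contr k : (K <= k)%N -> s k.+1 <= rho * s k.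
  move=> Kk; rewrite /rho mulrAC ler_pdivlMr ?addr_gt0//.
  suff : s k.+1 <= c * (s k - s k.+1) by lra.
  have /andP[s0 _] := s01 _ (leqW Kk).
  rewrite -[leLHS]powRr1 ?(ltW s0)// -[X in _ `^ X](@mulVf _ 2)// powRrM.
  rewrite powR_mulrn ?powR_ge0//.
  apply: (@le_trans _ _ ((A * enorm (z k.+1 - z k)) ^+ 2)).
    by rewrite lerXn2r ?nnegrE ?powR_ge0 ?plk// mulr_ge0 ?enorm_ge0 ?ltW.
  rewrite exprMn /c -[_ / a * _]mulrA ler_pM2l ?exprn_gt0//.
  by rewrite ler_pdivlMl// desc.
have geo j : s (K + j)%N <= rho ^+ j * s K.
  elim: j => [|j IH]; first by rewrite addn0 mul1r.
  rewrite addnS exprS -mulrA; apply: le_trans (contr _ (leq_addr _ _)) _.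
  by rewrite ler_pM2l//; case/andP: rho01.
have /andP[r0 r1] := rho01.
pose tau := Num.sqrt rho.
have tau0 : 0 < tau by rewrite sqrtr_gt0.
have tau1 : tau < 1 by rewrite -sqrtr1 ltr_sqrt.
have /andP[sK0 _] := s01 _ (leqnn K).
(* The error at k = K + 1 + j is at most C s_{K+j}^(1/2) <= C s_K^(1/2) tau^j; dividing by tau^(K+1)
   turns tau^j into tau^k. *)
pose c1 := C * Num.sqrt (s K) / tau ^+ K.+1.
have c10 : 0 < c1 by rewrite divr_gt0 ?exprn_gt0// mulr_gt0// sqrtr_gt0.
have [k _||c2 c20 zc] := @eventually_le_scale _ (fun k => enorm (z k - zs))
  (fun k => c1 * tau ^+ k); [by rewrite mulr_gt0// exprn_gt0| |]; last first.
  exists (c2 * c1), tau; split; [exact: mulr_gt0|by rewrite ltW|].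
  by move=> k /zc; rewrite mulrA.
exists K.+1 => // k /= /subnKC <-; move: (k - K.+1)%N => j.
rewrite addSn; apply: le_trans (Cs _ (leq_addr _ _)) _.
rewrite -addSn exprD /c1 mulrA divfK ?gt_eqF ?exprn_gt0// -mulrA ler_pM2l//.
have -> : 1 - 2^-1 = 2^-1 :> R by lra.
have /andP[sj _] := s01 _ (leq_addr j K).
rewrite powR12_sqrt ?(ltW sj)//.
rewrite -[tau ^+ j]ger0_norm ?exprn_ge0 ?(ltW tau0)// -sqrtr_sqr -sqrtrM ?(ltW sK0)//.
by rewrite ler_wsqrtr// -exprM mulnC exprM sqr_sqrtr ?(ltW r0)// mulrC.
Qed.

(** Discrete counterpart of: if -s' >= s^(1 + r) / c, then s^(-r) grows at least linearly. The
    tangent inequality at v / u gives v^(-r) - u^(-r) >= r v^(-r) (u - v) / u. Moreover u = v + (u -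
    v) <= (1 + c) v^(-r) (u - v), where v <= 1 bounds the second summand. *)
Lemma powR_gap (R : realType) (u v r c : R) : 0 < r < 1 -> 0 < c ->
  0 < v <= 1 -> v <= u -> v `^ (1 + r) <= c * (u - v) ->
  r / (1 + c) <= v `^ (- r) - u `^ (- r).
Proof.
move=> r01 c0 /andP[v0 v1] vu vc; have /andP[r0 r1] := r01.
have u0 := lt_le_trans v0 vu.
have := powR_le_tangent (divr_ge0 (ltW v0) (ltW u0)) r01.
have w0 := powR_gt0 (- r) v0.
rewrite -(ler_pM2r w0) powRM ?invr_ge0 ?(ltW v0) ?(ltW u0)//.
rewrite -(powR_inv1 (ltW u0)) -powRrM mulN1r mulrAC -powRD; last first.
  by rewrite (gt_eqF v0) implybT.
rewrite subrr powRr0 mul1r (powR_inv1 (ltW u0)) => h.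
have vr : v `^ (- r) * v `^ (1 + r) = v.
  by rewrite -powRD ?(gt_eqF v0) ?implybT// addrC addrK powRr1 ?ltW.
have w1 : 1 <= v `^ (- r).
  rewrite -[leLHS](powRr0 v); apply: ger_powR; first by rewrite v0.
  by rewrite oppr_le0 ltW.
suff : r / (1 + c) <= r * (v `^ (- r) * (u - v) / u).
  have -> : v `^ (- r) * (u - v) / u = v `^ (- r) * (1 - v / u).
    by field; rewrite gt_eqF.
  by lra.
rewrite ler_pM2l// ler_pdivlMr// mulrC ler_pdivrMr ?addr_gt0//.
have : v `^ (- r) * v `^ (1 + r) <= v `^ (- r) * (c * (u - v)) by rewrite ler_pM2l.
rewrite vr; have : 1 * (u - v) <= v `^ (- r) * (u - v).
  by rewrite ler_wpM2r// subr_ge0.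
by lra.
Qed.

Lemma PLK_polynomial (R : realType) d (z : nat -> 'rV[R]_d) (zs : 'rV[R]_d)
    (s : nat -> R) (a A q : R) (K : nat) :
  z @ \oo --> zs -> 0 < a -> 0 < A -> 2^-1 < q < 1 ->
  (forall k, (K <= k)%N -> 0 < s k <= 1) ->
  (forall k, (K <= k)%N -> a * enorm (z k.+1 - z k) ^+ 2 <= s k - s k.+1) ->
  (forall k, (K <= k)%N -> s k.+1 `^ q <= A * enorm (z k.+1 - z k)) ->
  exists2 gamma : R, 0 < gamma & forall k, (0 < k)%N ->
    enorm (z k - zs) <= gamma * k%:R `^ (- ((1 - q) / (2 * q - 1))).
Proof.
move=> zzs a0 A0 /andP[q2 q1] s01 desc plk.
have [|C C0 Cs] := enorm_le_value zzs a0 A0 _ s01 desc plk.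
  by rewrite ltW.
(* Since 1 + r = 2q, the squared PLK inequality reads s_{k+1}^(1 + r) <= c (s_k - s_{k+1}), as
   [powR_gap] requires. *)
pose r := 2 * q - 1; have r01 : 0 < r < 1 by rewrite /r; lra.
have /andP[r0 r1] := r01.
pose c := A ^+ 2 / a; have c0 : 0 < c by rewrite divr_gt0 ?exprn_gt0.
pose b := r / (1 + c); have b0 : 0 < b by rewrite divr_gt0// addr_gt0.
have gap k : (K <= k)%N -> s k `^ (- r) + b <= s k.+1 `^ (- r).
  move=> Kk; rewrite addrC -lerBrDr.
  have De := desc _ Kk; have D2 := sqr_ge0 (enorm (z k.+1 - z k)).
  apply: powR_gap => //; first exact: s01 (leqW Kk).
    by rewrite -subr_ge0; apply: le_trans De; rewrite mulr_ge0// ltW.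
  rewrite (_ : 1 + r = q * 2); last by rewrite /r; ring.
  rewrite powRrM powR_mulrn ?powR_ge0//.
  apply: (@le_trans _ _ ((A * enorm (z k.+1 - z k)) ^+ 2)).
    by rewrite lerXn2r ?nnegrE ?powR_ge0 ?plk// mulr_ge0 ?enorm_ge0 ?ltW.
  rewrite exprMn /c -[_ / a * _]mulrA ler_pM2l ?exprn_gt0//.
  by rewrite ler_pdivlMl.
have grow j : b * j%:R <= s (K + j)%N `^ (- r).
  elim: j => [|j IH]; first by rewrite mulr0 powR_ge0.
  rewrite addnS; apply: le_trans (gap _ (leq_addr _ _)).
  by rewrite -natr1 mulrDr mulr1 lerD2r.
(* As 1 - q = r p, the bound s_{K+j}^(-r) >= b j becomes s_{K+j}^(1 - q) <= (b j)^(-p). *)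
pose p := (1 - q) / r; have p0 : 0 < p by rewrite divr_gt0// subr_gt0.
have h0 : 0 < C * (b / 2) `^ (- p) by rewrite mulr_gt0// powR_gt0// divr_gt0.
have [k k0||c2 c20 zc] := @eventually_le_scale _ (fun k => enorm (z k - zs))
  (fun k => C * (b / 2) `^ (- p) * k%:R `^ (- p));
  [by rewrite mulr_gt0// powR_gt0// ltr0n| |]; last first.
  exists (c2 * (C * (b / 2) `^ (- p))); first exact: mulr_gt0.
  by move=> k /zc; rewrite mulrA.
(* From this rank on, k = K + j + 1 with j > K, so j >= k / 2; hence b / 2 in the constant. *)
exists (K.+1 + K.+1)%N => // k /= Kk.
have [j jk Kj] : exists2 j, k = (K + j).+1 & (K < j)%N.
  exists (k - K.+1)%N; last by rewrite ltn_subRL (leq_trans _ Kk)// addnS ltnS.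
  by rewrite -addSn subnKC// (leq_trans _ Kk)// leq_addr.
have j0 : (0 < j)%N by rewrite (leq_trans _ Kj).
rewrite jk; apply: le_trans (Cs _ (leq_addr _ _)) _.
have b20 : 0 < b / 2 by rewrite divr_gt0.
rewrite -mulrA ler_pM2l// -powRM ?ler0n ?(ltW b20)//.
have /andP[sj _] := s01 _ (leq_addr j K).
have -> : s (K + j)%N `^ (1 - q) = (s (K + j)%N `^ (- r)) `^ (- p).
  by rewrite -powRrM mulrNN mulrC /p divfK// gt_eqF.
have bk0 : 0 < b / 2 * (K + j).+1%:R by rewrite mulr_gt0 ?ltr0n.
rewrite !(powRN _ p) lef_pV2 ?posrE ?(powR_gt0 _ bk0) ?powR_gt0//.
apply: ge0_ler_powR; rewrite ?nnegrE ?powR_ge0 ?(ltW p0)//.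
  exact: ltW.
apply: le_trans (grow j); rewrite -mulrA ler_pM2l// mulrC ler_pdivrMr//.
by rewrite -natrM ler_nat muln2 -addnn -addSn leq_add2r.
Qed.

(** * First-order expansions and a Frechet subgradient of the objective *)

Lemma dotv_row_mx (R : realType) n m (a c : 'rV[R]_n) (b d : 'rV[R]_m) :
  dotv (row_mx a b) (row_mx c d) = dotv a c + dotv b d.
Proof.
rewrite /dotv big_split_ord /=.
by congr (_ + _); apply: eq_bigr => i _; rewrite ?row_mxEl ?row_mxEr.
Qed.

(** Expanding h in the standard basis identifies the differential with the inner product by the
    gradient. The remainder is little-o of the sup norm, which the Euclidean norm dominates. *)
Lemma gradient_expansion (R : realType) d (F : 'rV[R]_d -> R) z (e : R) :
  differentiable F z -> 0 < e ->
  \forall u \near z,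
    `|F u - F z - dotv (gradient F z) (u - z)| <= e * enorm (u - z).
Proof.
move=> dF e0.
have dE h : 'd F z h = dotv (gradient F z) h.
  rewrite {1}(row_sum_delta h) linear_sum /dotv; apply: eq_bigr => i _.
  by rewrite linearZ /= /gradient mxE deriveE// mulrC.
have /eqaddoP /(_ _ e0) := diff_locally dF.
rewrite (near_shift 0 z); apply: filterS => h /=.
rewrite !fctE /= subr0 addrK dE opprD addrA => /le_trans; apply.
by rewrite ler_pM2l// normv_le_enorm.
Qed.

(** The slack e |u - x| bounds the difference quotient below by -e on a punctured neighborhood, for
    every e > 0. *)
Lemma frechet_subdiffI (R : realType) d (h : 'rV[R]_d -> \bar R) x v (r : R) :
  h x = r%:E ->
  (forall e : R, 0 < e -> \forall u \near x,
     ((r + dotv v (u - x) - e * enorm (u - x))%:E <= h u)%E) ->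
  frechet_subdiff h x v.
Proof.
move=> hx hv; split; first by rewrite /effective_dom /= hx ltry.
rewrite limf_einfE; apply/lee_addgt0Pr => e e0.
rewrite -leeBlDr// sub0e.
apply: le_trans (ereal_sup_ubound _); last first.
  exists [set u | u != x /\ ((r + dotv v (u - x) - e * enorm (u - x))%:E <= h u)%E].
    by apply: filterS (hv _ e0) => u hu ux; split.
  by [].
apply: le_ereal_inf_tmp => _ [u [ux hu] <-].
have n0 : 0 < enorm (u - x).
  rewrite lt_def enorm_ge0 andbT; apply: contra_neq ux => /enorm_eq0 /eqP.
  by rewrite subr_eq0 => /eqP.
rewrite hx; move: hu; case: (h u) => [t| |]//=; last first.
  by move=> _; rewrite !addye// gt0_mulye ?lte_fin ?invr_gt0// leey.
rewrite !lee_fin ler_pdivlMr//; lra.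
Qed.

(** Here (p, s) is the old iterate, (a, b) the new one, and l, k are the proximal weights.
    Optimality of a involves Q at the old s; the gradient difference in the first block corrects for
    this. *)
Lemma alternating_subgradient (R : realType) n m (f : 'rV[R]_n -> \bar R)
    (Q : 'rV[R]_(n + m) -> R) (g : 'rV[R]_m -> \bar R)
    (p a : 'rV[R]_n) (s b : 'rV[R]_m) (fa gb l k : R) :
  (forall w, differentiable Q w) -> f a = fa%:E -> g b = gb%:E ->
  (forall u, ((fa + Q (row_mx a s) - Q (row_mx u s)
     + l * (enorm (a - p) ^+ 2 - enorm (u - p) ^+ 2))%:E <= f u)%E) ->
  (forall v, ((gb + Q (row_mx a b) - Q (row_mx a v)
     + k * (enorm (b - s) ^+ 2 - enorm (v - s) ^+ 2))%:E <= g v)%E) ->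
  frechet_subdiff (objective f Q g) (row_mx a b)
    (row_mx (lsubmx (gradient Q (row_mx a b) - gradient Q (row_mx a s))
             - (2 * l) *: (a - p))
            (- ((2 * k) *: (b - s)))).
Proof.
move=> dQ fa_ gb_ fmin gmin.
apply: (@frechet_subdiffI _ _ _ _ _ (fa + Q (row_mx a b) + gb)).
  by rewrite /objective row_mxKl row_mxKr fa_ gb_.
(* One quarter of e for each of the three expansions of Q and one for the quadratic remainder. *)
move=> e e0; have e4 : 0 < e / 4 by rewrite divr_gt0.
have [d1 d10 Q1] := enorm_lt_near (gradient_expansion (dQ (row_mx a s)) e4).
have [d2 d20 Q2] := enorm_lt_near (gradient_expansion (dQ (row_mx a b)) e4).
(* Within this radius, |l| + |k| times the squared distance is at most e / 4 times the distance. *)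
have d30 : 0 < e / 4 / (`|l| + `|k| + 1) by rewrite divr_gt0// ltr_wpDl// addr_ge0.
suff key u v : enorm (row_mx (u - a) (v - b)) < Num.min (Num.min d1 d2)
    (e / 4 / (`|l| + `|k| + 1)) ->
    ((fa + Q (row_mx a b) + gb + dotv (row_mx (lsubmx (gradient Q (row_mx a b)
         - gradient Q (row_mx a s)) - (2 * l) *: (a - p))
         (- ((2 * k) *: (b - s)))) (row_mx (u - a) (v - b))
       - e * enorm (row_mx (u - a) (v - b)))%:E
     <= objective f Q g (row_mx u v))%E.
  near=> w; rewrite -(hsubmxK w) opp_row_mx add_row_mx; apply: key.
  rewrite -add_row_mx -opp_row_mx hsubmxK; near: w.
  by apply: near_enorm_lt; rewrite !lt_min d10 d20.
rewrite !lt_min => /andP[/andP[w1 w2] w3].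
have [nu nv] := enorm_row_mx_ge (u - a) (v - b).
have hu : row_mx u s - row_mx a s = row_mx (u - a) 0.
  by rewrite opp_row_mx add_row_mx subrr.
have hv : row_mx a v - row_mx a b = row_mx 0 (v - b).
  by rewrite opp_row_mx add_row_mx subrr.
have eu : enorm (row_mx (u - a) (0 : 'rV[R]_m)) <= enorm (row_mx (u - a) (v - b)).
  by apply: le_trans (enorm_row_mx_le _ _) _; rewrite enorm0 addr0.
have ev : enorm (row_mx (0 : 'rV[R]_n) (v - b)) <= enorm (row_mx (u - a) (v - b)).
  by apply: le_trans (enorm_row_mx_le _ _) _; rewrite enorm0 add0r.
have h1 : `|Q (row_mx u s) - Q (row_mx a s) -
    dotv (gradient Q (row_mx a s)) (row_mx (u - a) 0)| <=
    e / 4 * enorm (row_mx (u - a) (v - b)).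
  have := Q1 (row_mx u s); rewrite hu => /(_ (le_lt_trans eu w1))/le_trans; apply.
  by rewrite ler_pM2l.
have h3 : `|Q (row_mx a v) - Q (row_mx a b) -
    dotv (gradient Q (row_mx a b)) (row_mx 0 (v - b))| <=
    e / 4 * enorm (row_mx (u - a) (v - b)).
  have := Q2 (row_mx a v); rewrite hv => /(_ (le_lt_trans ev w2))/le_trans; apply.
  by rewrite ler_pM2l.
have h2 := Q2 (row_mx u v); rewrite opp_row_mx add_row_mx in h2.
move: h2 => /(_ w2) h2.
rewrite /objective row_mxKl row_mxKr.
apply: le_trans (leeD (leeD (fmin u) (lexx _)) (gmin v)).
rewrite -!EFinD lee_fin.
(* Expansion of the proximal squares around the new iterate: the linear part enters the subgradient,
   the quadratic part is left to [quad]. *)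
have sq d (x y t : 'rV[R]_d) : enorm (x - y) ^+ 2 =
    enorm (x - t) ^+ 2 + 2 * dotv (t - y) (x - t) + enorm (t - y) ^+ 2.
  rewrite !sqr_enorm !dotvDl !dotvDr !dotvNl !dotvNr.
  rewrite (dotvC y x) (dotvC t x) (dotvC y t); ring.
rewrite (sq _ u p a) (sq _ v s b).
move: h1 h2 h3; rewrite -(hsubmxK (gradient Q (row_mx a b))).
rewrite -(hsubmxK (gradient Q (row_mx a s))) !opp_row_mx !add_row_mx row_mxKl.
rewrite !dotv_row_mx !dotvDl !dotvNl !dotvZl !dotvDl !dotvNl.
have dot0 d (x : 'rV[R]_d) : dotv x 0 = 0 by rewrite -(scale0r 0) dotvZr mul0r.
rewrite !dot0 !addr0 !add0r !ler_norml.
move=> /andP[_ h1] /andP[h2 _] /andP[_ h3].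
have quad : l * enorm (u - a) ^+ 2 + k * enorm (v - b) ^+ 2 <=
    e / 4 * enorm (row_mx (u - a) (v - b)).
  move: (enorm (row_mx _ _)) (enorm_ge0 (row_mx (u - a) (v - b))) nu nv w3.
  move=> N N0 nu nv; rewrite ltr_pdivlMr ?ltr_wpDl ?addr_ge0// => /ltW w3.
  have aux c x : 0 <= x -> x <= N -> c * x ^+ 2 <= `|c| * N ^+ 2.
    move=> x0 xN; apply: (@le_trans _ _ (`|c| * x ^+ 2)).
      by rewrite ler_wpM2r ?sqr_ge0// ler_norm.
    by rewrite ler_wpM2l// lerXn2r// nnegrE.
  have := ler_wpM2r N0 w3; have := sqr_ge0 N.
  have := aux l _ (enorm_ge0 _) nu; have := aux k _ (enorm_ge0 _) nv; lra.
move: quad; lra.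
Unshelve. all: end_near. Qed.

(** * Finiteness and convergence of the values *)

(** Comparison with a point where h is finite makes h a finite; the inequality can then be
    rearranged in the reals. *)
Lemma argmin_real_part (R : realType) d (h F : 'rV[R]_d -> \bar R)
    (r : 'rV[R]_d -> R) (a : 'rV[R]_d) :
  proper_fun h -> (forall u, F u = (h u + (r u)%:E)%E) -> argmin F a ->
  h a \is a fin_num /\
  forall u, ((fine (h a) + r a - r u)%:E <= h u)%E.
Proof.
move=> [hNy [u0 hu0]] FE amin.
have ha : h a \is a fin_num.
  have := amin u0; rewrite !FE -(fineK hu0).
  by have := hNy a; case: (h a).
split=> // u; have := amin u; rewrite !FE -(fineK ha) /=.
have := hNy u; case: (h u) => [t _| |]//; rewrite ?leey// !lee_fin; lra.
Qed.

(** Finiteness spreads alternately: properness of L(., y_0) makes g(y_0) finite, then f(x_1),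
    g(y_1), f(x_2) and so on. The value f(x_0) may be infinite, hence [F k.+1] against [G k]. *)
Lemma alternating_minimization_real (R : realType) (n m : nat)
    (f : 'rV[R]_n -> \bar R) (Q : 'rV[R]_(n + m) -> R)
    (g : 'rV[R]_m -> \bar R) x0 y0 lam mu x y :
  proper_fun f -> proper_fun g ->
  proper_fun (fun u => objective f Q g (row_mx u y0)) ->
  alternating_minimization (objective f Q g) x0 y0 lam mu x y ->
  exists F G : nat -> R,
  [/\ forall k, f (x k.+1) = (F k.+1)%:E, forall k, g (y k) = (G k)%:E,
      forall k u, ((F k.+1 + Q (row_mx (x k.+1) (y k)) - Q (row_mx u (y k))
        + (2 * lam k)^-1 *
          (enorm (x k.+1 - x k) ^+ 2 - enorm (u - x k) ^+ 2))%:E <= f u)%E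
    & forall k v, ((G k.+1 + Q (row_mx (x k.+1) (y k.+1))
        - Q (row_mx (x k.+1) v) + (2 * mu k)^-1 *
          (enorm (y k.+1 - y k) ^+ 2 - enorm (v - y k) ^+ 2))%:E <= g v)%E].
Proof.
move=> pf pg [_ [u0]]; rewrite /objective row_mxKl row_mxKr !fin_numD.
move=> /andP[_ gy0] [_ y0E alg].
have stepx k : g (y k) \is a fin_num -> f (x k.+1) \is a fin_num /\
    forall u, ((fine (f (x k.+1)) + Q (row_mx (x k.+1) (y k))
      - Q (row_mx u (y k)) + (2 * lam k)^-1 *
      (enorm (x k.+1 - x k) ^+ 2 - enorm (u - x k) ^+ 2))%:E <= f u)%E.
  move=> gk; have [argx _] := alg k.
  have [u|fk fmin] := argmin_real_part (r := fun u => Q (row_mx u (y k))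
    + fine (g (y k)) + (2 * lam k)^-1 * enorm (u - x k) ^+ 2) pf _ argx.
    by rewrite /objective row_mxKl row_mxKr -{1}(fineK gk) !EFinD !addeA.
  split=> // u; apply: le_trans (fmin u); rewrite lee_fin; lra.
have stepy k : f (x k.+1) \is a fin_num -> g (y k.+1) \is a fin_num /\
    forall v, ((fine (g (y k.+1)) + Q (row_mx (x k.+1) (y k.+1))
      - Q (row_mx (x k.+1) v) + (2 * mu k)^-1 *
      (enorm (y k.+1 - y k) ^+ 2 - enorm (v - y k) ^+ 2))%:E <= g v)%E.
  move=> fk; have [_ argy] := alg k.
  have [v|gk gmin] := argmin_real_part (r := fun v => fine (f (x k.+1))
    + Q (row_mx (x k.+1) v) + (2 * mu k)^-1 * enorm (v - y k) ^+ 2) pg _ argy.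
    rewrite /objective row_mxKl row_mxKr -{1}(fineK fk) EFinD addeA.
    by rewrite -EFinD (addeC _ (g v)).
  split=> // v; apply: le_trans (gmin v); rewrite lee_fin; lra.
have gfin k : g (y k) \is a fin_num.
  elim: k => [|k /stepx[/stepy[]//]]; by rewrite y0E.
exists (fun k => fine (f (x k))), (fun k => fine (g (y k))); split=> k.
- by rewrite fineK//; case: (stepx _ (gfin k)).
- by rewrite fineK.
- by case: (stepx _ (gfin k)).
- by case: (stepx _ (gfin k)) => /stepy[].
Qed.

Lemma lower_semicontinuous_enorm (R : realType) d (h : 'rV[R]_d -> \bar R)
    (x : 'rV[R]_d) (r e : R) : lower_semicontinuous h -> h x = r%:E -> 0 < e ->
  exists2 del : R, 0 < del &
    forall u, enorm (u - x) < del -> ((r - e)%:E < h u)%E.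
Proof.
move=> lsc hx e0.
have [|V Vx Vh] := lsc x (r - e); first by rewrite hx lte_fin ltrBlDr ltrDl.
by have [del del0 hdel] := enorm_lt_near Vx; exists del => // u /hdel /Vh.
Qed.

Lemma continuous_enorm (R : realType) d (F : 'rV[R]_d -> R)
    (x : 'rV[R]_d) (e : R) : {for x, continuous F} -> 0 < e ->
  exists2 del : R, 0 < del &
    forall u, enorm (u - x) < del -> `|F u - F x| < e.
Proof.
move=> cF e0; have [del del0 hdel] := enorm_lt_near (cvgr_dist_lt F _ cF _ e0).
by exists del => // u /hdel; rewrite distrC.
Qed.

(* Lower semicontinuity bounds the values from below; comparing the iterates
   with the competitors xs and ys bounds them from above. *)
Lemma objective_value_cvg (R : realType) (n m : nat) (f : 'rV[R]_n -> \bar R)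
    (Q : 'rV[R]_(n + m) -> R) (g : 'rV[R]_m -> \bar R)
    (lam mu : nat -> R) (x : nat -> 'rV[R]_n) (y : nat -> 'rV[R]_m) xs ys
    (F G : nat -> R) (fs gs c : R) :
  lower_semicontinuous f -> lower_semicontinuous g ->
  {for row_mx xs ys, continuous Q} ->
  (forall k, 0 < lam k <= c) -> (forall k, 0 < mu k <= c) ->
  (fun k => row_mx (x k) (y k)) @ \oo --> row_mx xs ys ->
  f xs = fs%:E -> g ys = gs%:E ->
  (forall k, f (x k.+1) = (F k.+1)%:E) -> (forall k, g (y k) = (G k)%:E) ->
  (forall k u, ((F k.+1 + Q (row_mx (x k.+1) (y k)) - Q (row_mx u (y k))
        + lam k *
          (enorm (x k.+1 - x k) ^+ 2 - enorm (u - x k) ^+ 2))%:E <= f u)%E) ->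
  (forall k v, ((G k.+1 + Q (row_mx (x k.+1) (y k.+1))
        - Q (row_mx (x k.+1) v) + mu k *
          (enorm (y k.+1 - y k) ^+ 2 - enorm (v - y k) ^+ 2))%:E <= g v)%E) ->
  (fun k => F k + Q (row_mx (x k) (y k)) + G k - (fs + Q (row_mx xs ys) + gs))
    @ \oo --> 0.
Proof.
move=> lf lg cQ lamc muc zzs fxs gys FE GE fmin gmin.
apply/cvgr0Pnorm_le => e e0.
(* The lower estimate spends three errors of size e / 8, the upper one five. *)
have e8 : 0 < e / 8 by rewrite divr_gt0.
have [d1 d10 hf] := lower_semicontinuous_enorm lf fxs e8.
have [d2 d20 hg] := lower_semicontinuous_enorm lg gys e8.
have [d3 d30 hQ] := continuous_enorm cQ e8.
have c0 : 0 < c by have /andP[a b] := lamc 0%N; apply: lt_le_trans b.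
have d40 : 0 < Num.min 1 (e / 8 / c) by rewrite lt_min ltr01 divr_gt0.
have [N _ zN] := @enorm_cvg_lt _ _ _ _ zzs
  (Num.min (Num.min d1 d2) (Num.min (d3 / 2) (Num.min 1 (e / 8 / c))))
  ltac:(by rewrite !(lt_min 0) d10 d20 divr_gt0// ltr01 !divr_gt0).
exists N.+1 => // -[//|k] /=; rewrite ltnS => Nk.
have := zN _ (leqW Nk); have := zN _ Nk => /=; rewrite !lt_min.
rewrite !opp_row_mx !add_row_mx.
have [ax ay] := enorm_row_mx_ge (x k - xs) (y k - ys).
have [bx by_] := enorm_row_mx_ge (x k.+1 - xs) (y k.+1 - ys).
move: (enorm (row_mx (x k - xs) _)) (enorm (row_mx (x k.+1 - xs) _)) ax ay bx by_.
move=> A B ax ay bx by_ /andP[/andP[A1 A2] /and3P[A3 A4 A5]].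
move=> /andP[/andP[B1 B2] /and3P[B3 B4 B5]].
(* Q is also evaluated at pairs mixing successive iterates or an iterate and the limit;
   componentwise bounds, whence d3 / 2, cover them all. *)
have rowd (u : 'rV[R]_n) (v : 'rV[R]_m) : enorm (u - xs) < d3 / 2 ->
    enorm (v - ys) < d3 / 2 ->
    - (e / 8) <= Q (row_mx u v) - Q (row_mx xs ys) <= e / 8.
  move=> hu hv; rewrite -ler_norml ltW// hQ// opp_row_mx add_row_mx.
  apply: le_lt_trans (enorm_row_mx_le _ _) _; lra.
have f1 := hf _ (le_lt_trans bx B1); have g1 := hg _ (le_lt_trans by_ B2).
rewrite FE lte_fin in f1; rewrite GE lte_fin in g1.
have := fmin k xs; rewrite fxs lee_fin => f2.
have := gmin k ys; rewrite gys lee_fin => g2.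
(* Here p is the distance from the competitor to the old iterate, so that p^2 <= w < e / (8 c); the
   square of q only helps. *)
have prox p q t w : 0 < t <= c -> 0 <= p -> p <= w -> w < 1 -> w < e / 8 / c ->
    t * (q ^+ 2 - p ^+ 2) >= - (e / 8).
  move=> /andP[t0 tc] p0 pw w1; rewrite ltr_pdivlMr// => we.
  have := sqr_ge0 q; have : t * p ^+ 2 <= e / 8; last by nra.
  apply: (@le_trans _ _ (c * w)); last by lra.
  apply: ler_pM; rewrite ?sqr_ge0 ?(ltW t0)// expr2.
  by apply: (le_trans _ pw); rewrite ler_piMr// (le_trans pw)// ltW.
rewrite (enorm_distC xs) in f2; rewrite (enorm_distC ys) in g2.
have p1 := prox _ (enorm (x k.+1 - x k)) _ _ (lamc k) (enorm_ge0 _) ax A4 A5.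
have p2 := prox _ (enorm (y k.+1 - y k)) _ _ (muc k) (enorm_ge0 _) ay A4 A5.
have /andP[q1 q1'] := rowd _ _ (le_lt_trans bx B3) (le_lt_trans ay A3).
have xs0 : enorm (xs - xs) < d3 / 2 by rewrite subrr enorm0 divr_gt0.
have ys0 : enorm (ys - ys) < d3 / 2 by rewrite subrr enorm0 divr_gt0.
have /andP[q2 q2'] := rowd _ _ xs0 (le_lt_trans ay A3).
have /andP[q3 q3'] := rowd _ _ (le_lt_trans bx B3) (le_lt_trans by_ B3).
have /andP[q4 q4'] := rowd _ _ (le_lt_trans bx B3) ys0.
rewrite ler_norml; apply/andP; split; lra.
Qed.

(** * Local consequences of the hypotheses at the limit point *)

(** A Frechet subgradient is a limiting one, by constant sequences, so its norm bounds the distance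
    in the PLK condition; the power comes from phi'(t) = M (1 - q) t^(-q). *)
Lemma exponent_PLK_bound (R : realType) d (h : 'rV[R]_d -> \bar R)
    (xbar : 'rV[R]_d) (M q r : R) :
  0 < M -> q < 1 -> h xbar = r%:E -> exponent_PLK h xbar M q ->
  exists del eta : R, [/\ 0 < del, 0 < eta &
    forall w v t, enorm (w - xbar) < del -> h w = t%:E -> r < t < r + eta ->
      frechet_subdiff h w v ->
      (t - r) `^ q <= M * (1 - q) * enorm v].
Proof.
move=> M0 q1 hx [_ [eta eta0 /enorm_lt_near[del del0 near_plk]]].
exists del, eta; split=> // w v t /near_plk; rewrite hx => + ht.
rewrite ht => + /andP[rt tr] subv.
rewrite -EFinD !lte_fin => /(_ rt tr).
have tr0 : 0 < t - r by rewrite subr_gt0.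
have -> : derive1 (fun t => M * t `^ (1 - q)) (fine (t%:E - r%:E)) =
    M * ((1 - q) * (t - r) `^ (- q)).
  have := is_deriveZ M (is_derive1_powR (1 - q) tr0).
  rewrite (_ : 1 - q - 1 = - q); last by ring.
  by rewrite derive1E /= => -[].
have lim0 : limiting_subdiff h w v.
  split; first by rewrite /effective_dom /= ht ltry.
  by exists (fun=> w), (fun=> v); split=> //; exact: cvg_cst.
have c0 : 0 < M * ((1 - q) * (t - r) `^ (- q)).
  by rewrite !mulr_gt0 ?powR_gt0 ?subr_gt0.
have : (dist_to_set 0 (limiting_subdiff h w) <= (enorm v)%:E)%E.
  by apply: ereal_inf_lbound; exists v => //; rewrite sub0r enormN.
rewrite -(@lee_pmul2l _ (M * ((1 - q) * (t - r) `^ (- q)))%:E)// => dv plk.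
have := le_trans plk dv.
rewrite -EFinM lee_fin powRN.
rewrite (_ : M * (_ / _) * enorm v = M * (1 - q) * enorm v / (t - r) `^ q); last by ring.
by rewrite ler_pdivlMr ?powR_gt0// mul1r.
Qed.

Lemma gradient_lipschitz_near (R : realType) d (F : 'rV[R]_d -> R)
    (a : 'rV[R]_d) : gradient_lipschitz_on_bounded F ->
  exists2 K : R, 0 <= K & forall z w, enorm (z - a) < 1 -> enorm (w - a) < 1 ->
    enorm (gradient F z - gradient F w) <= K * enorm (z - w).
Proof.
move=> /(_ [set w | enorm (w - a) < 1])[|K FK].
  exists (`|a| + 1); split; first exact: num_real.
  move=> r ar w /= wa; rewrite (le_trans _ (ltW ar))// -(subrK a w) addrC.
  apply: le_trans (ler_normD _ _) _; rewrite lerD2l.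
  by apply: le_trans (normv_le_enorm _) _; rewrite ltW.
exists `|K| => // z w za wa; apply: le_trans (FK _ _ za wa) _.
by rewrite ler_wpM2r ?enorm_ge0// ler_norm.
Qed.

(** The gaps are nonincreasing and nonnegative, so they stay 0 and every later step vanishes;
    telescoping with zero potential identifies the constant iterate with the limit. *)
Lemma stationary_termination (R : realType) d (z : nat -> 'rV[R]_d)
    (zs : 'rV[R]_d) (s : nat -> R) (a : R) (K : nat) :
  z @ \oo --> zs -> 0 < a -> (forall k, (K <= k)%N -> 0 <= s k) -> s K = 0 ->
  (forall k, (K <= k)%N -> a * enorm (z k.+1 - z k) ^+ 2 <= s k - s k.+1) ->
  finite_termination z zs.
Proof.
move=> zzs a0 s0 sK desc.
have sk k : (K <= k)%N -> s k = 0.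
  move=> /subnKC <-; elim: (k - K)%N => [|j IH]; first by rewrite addn0.
  have Kj := leq_addr j K; have := desc _ Kj; have := s0 _ (leqW Kj).
  have := mulr_ge0 (ltW a0) (sqr_ge0 (enorm (z (K + j).+1 - z (K + j)%N))).
  rewrite addnS IH; lra.
exists K => // k /= Kk; apply/eqP; rewrite -subr_eq0; apply/eqP/enorm_eq0/eqP.
rewrite eq_le enorm_ge0 andbT.
apply: (@enorm_le_telescope _ _ z zs (fun=> 0) K) => // j Kj.
have := desc _ Kj; rewrite sk// (sk j.+1) ?leqW// subrr pmulr_rle0//.
rewrite real_exprn_even_le0 ?num_real//= => /eqP ->.
by [].
Qed.

(** * Decrease and PLK inequalities for the iterates, and the four rates *)

Theorem theorem4p3 (R : realType) (n m : nat)
    (f : 'rV[R]_n -> \bar R) (Q : 'rV[R]_(n + m) -> R) (g : 'rV[R]_m -> \bar R)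
    (x0 : 'rV[R]_n) (y0 : 'rV[R]_m) (lam mu : nat -> R)
    (x : nat -> 'rV[R]_n) (y : nat -> 'rV[R]_m)
    (xs : 'rV[R]_n) (ys : 'rV[R]_m) (M q : R)
    (L := objective f Q g)
    (z := fun k : nat => row_mx (x k) (y k))
    (zs := row_mx xs ys)
    (hH : assumption_H f Q g)
    (hH1 : assumption_H1 L y0 lam mu)
    (hlam : forall k, 0 < lam k)
    (hmu : forall k, 0 < mu k)
    (halg : alternating_minimization L x0 y0 lam mu x y)
    (hcvg : z @ \oo --> zs)
    (hstat : M_stationary L zs)
    (hM : 0 < M)
    (hq : 0 <= q < 1)
    (hPLK : exponent_PLK L zs M q) :
  [/\ q = 0 -> finite_termination z zs,
      0 < q < 2^-1 -> finite_termination z zs \/ superlinear_convergence z zs,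
      q = 2^-1 -> linear_convergence z zs
    & 2^-1 < q < 1 ->
      exists2 gamma : R, 0 < gamma &
        forall k : nat, (0 < k)%N ->
          enorm (z k - zs) <= gamma * k%:R `^ (- ((1 - q) / (2 * q - 1)))].
Proof.
have [[pf lf] [pg lg] [dQ _] lipQ] := hH.
have [_ pL [rm [rp [rm0 rmp steps]]]] := hH1.
have /andP[q0 q1] := hq.
have [F [G [FE GE fmin gmin]]] := alternating_minimization_real pf pg pL halg.
have rp0 : 0 < rp by apply: lt_trans rmp.
have step01 (t : R) : rm < t < rp -> (2 * rp)^-1 <= (2 * t)^-1 <= (2 * rm)^-1.
  move=> /andP[t1 t2]; have t0 := lt_trans rm0 t1.
  by rewrite !lef_pV2 ?posrE ?mulr_gt0// !ler_pM2l// !ltW.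
have lam01 k := step01 _ (proj1 (andP (steps k))).
have mu01 k := step01 _ (proj2 (andP (steps k))).
(* The proximal weights 1 / (2 lam k) and 1 / (2 mu k) lie between a, the decrease constant, and c,
   which enters the subgradient bound. *)
pose a := (2 * rp)^-1; have a0 : 0 < a by rewrite invr_gt0 mulr_gt0.
pose c := (2 * rm)^-1; have c0 : 0 < c by rewrite invr_gt0 mulr_gt0.
have [fxs gys] : f xs \is a fin_num /\ g ys \is a fin_num.
  case: hPLK => + _; rewrite /effective_dom /= /L /objective row_mxKl row_mxKr.
  have := pf.1 xs; have := pg.1 ys.
  by case: (f xs) => [?||]//; case: (g ys) => [?||].
pose ls := fine (f xs) + Q zs + fine (g ys).
have Lzs : L zs = ls%:E.
  by rewrite /L /objective row_mxKl row_mxKr -(fineK fxs) -(fineK gys).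
pose s k := F k + Q (z k) + G k - ls.
have Lz k : L (z k.+1) = (s k.+1 + ls)%:E.
  by rewrite /L /objective row_mxKl row_mxKr FE GE /s subrK.
have s_cvg : s @ \oo --> 0.
  apply: (@objective_value_cvg _ _ _ f Q g (fun k => (2 * lam k)^-1)
    (fun k => (2 * mu k)^-1) x y xs ys F G _ _ c) => //.
  - exact: differentiable_continuous.
  - by move=> k; have /andP[_ ->] := lam01 k; rewrite invr_gt0 mulr_gt0.
  - by move=> k; have /andP[_ ->] := mu01 k; rewrite invr_gt0 mulr_gt0.
  - by rewrite fineK.
  - by rewrite fineK.
have zdiff k : z k.+1 - z k = row_mx (x k.+1 - x k) (y k.+1 - y k).
  by rewrite /z opp_row_mx add_row_mx.
(* Each block is compared with its previous value. The first rank is 1, as [F 0] need not be the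
   value f(x_0). *)
have desc k : (1 <= k)%N -> a * enorm (z k.+1 - z k) ^+ 2 <= s k - s k.+1.
  case: k => // k _.
  have := fmin k.+1 (x k.+1); have := gmin k.+1 (y k.+1).
  rewrite FE GE !lee_fin !subrr !enorm0 expr0n /= !subr0 zdiff sqr_enorm_row_mx.
  have /andP[h1 _] := lam01 k.+1; have /andP[h2 _] := mu01 k.+1.
  have := ler_wpM2r (sqr_ge0 (enorm (x k.+2 - x k.+1))) h1.
  have := ler_wpM2r (sqr_ge0 (enorm (y k.+2 - y k.+1))) h2.
  rewrite /s /z /a; lra.
have mono k : (1 <= k)%N -> s k.+1 <= s k.
  move=> /desc h; rewrite -subr_ge0; apply: le_trans h.
  by rewrite mulr_ge0 ?sqr_ge0// ltW.
(* By monotonicity a negative gap would keep all later ones away from the limit 0. *)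
have s_ge0 k : (1 <= k)%N -> 0 <= s k.
  move=> k1; rewrite leNgt; apply/negP => sk.
  have [N sN] := cvg0_norm_lt s_cvg (ltac:(by rewrite oppr_gt0) : 0 < - s k).
  have dec j : s (k + j)%N <= s k.
    elim: j => [|j]; rewrite ?addn0// addnS; apply: le_trans.
    by rewrite mono// (leq_trans k1)// leq_addr.
  have := sN _ (leq_addl k N); rewrite ltNge ler0_norm; last first.
    by apply: le_trans (dec N) _; exact: ltW.
  by rewrite lerN2 dec.
(* A vanishing gap settles all four claims by finite termination; otherwise all gaps are positive
   and the PLK inequality applies to them. *)
have [[K K1 sK]|spos] : (exists2 K, (1 <= K)%N & s K = 0) \/
    (forall k, (1 <= k)%N -> 0 < s k).
  have [h|h] := pselect (exists2 K, (1 <= K)%N & s K = 0); [by left|right].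
  move=> k k1; rewrite lt_def s_ge0// andbT; apply/eqP => sk.
  by apply: h; exists k.
- have fin : finite_termination z zs.
    apply: (@stationary_termination _ _ z zs s a K) => // k Kk.
      by rewrite s_ge0// (leq_trans K1).
    by rewrite desc// (leq_trans K1).
  split=> _; [exact: fin|by left|exact: finite_termination_linear|].
  exact: finite_termination_polynomial.
have [lip lip0 Qlip] := gradient_lipschitz_near zs lipQ.
have [del [eta [del0 eta0 plk]]] := exponent_PLK_bound hM q1 Lzs hPLK.
(* Radius 1/2 for two successive iterates keeps the mixed point (x_{k+1}, y_k) in the unit ball
   where the gradient is Lipschitz. *)
have [N0 zN0] : exists N, forall k, (N <= k)%N -> enorm (z k - zs) < Num.min del 2^-1.
  have e0 : 0 < Num.min del 2^-1 by rewrite lt_min del0 invr_gt0 ltr0n.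
  by have [N _ zN] := enorm_cvg_lt hcvg e0; exists N.
have e1 : 0 < Num.min eta 1 by rewrite lt_min eta0 ltr01.
have [N1 sN1] := cvg0_norm_lt s_cvg e1.
(* The successor ensures K >= 1, where the decrease starts. *)
pose K := (N0 + N1).+1.
(* M (1 - q) comes from phi', [lip] from the gradient difference, and each of the two proximal terms
   contributes 2 c. *)
pose A := M * (1 - q) * (lip + 2 * (2 * c)).
have A0 : 0 < A.
  by rewrite !mulr_gt0 ?subr_gt0// ltr_wpDl// !mulr_gt0.
have plkK k : (K <= k)%N -> s k.+1 `^ q <= A * enorm (z k.+1 - z k).
  move=> Kk.
  have N0k : (N0 <= k)%N by apply: leq_trans Kk; rewrite leqW// leq_addr.
  have N1k : (N1 <= k.+1)%N by apply: leq_trans (leqW Kk); rewrite leqW// leq_addl.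
  have := zN0 _ (leqW N0k); rewrite lt_min => /andP[z1 z1'].
  have := zN0 _ N0k; rewrite lt_min => /andP[z2 z2'].
  have := sN1 _ N1k; rewrite lt_min => /andP[s1 _].
  have sp := spos k.+1 isT; rewrite gtr0_norm// in s1.
  have sub := alternating_subgradient (Q := Q) dQ (FE k) (GE k.+1) (fmin k) (gmin k).
  have := plk _ _ _ z1 (Lz k) _ sub.
  rewrite addrK ltrDr sp addrC ltrD2l s1 => /(_ isT) /le_trans; apply.
  rewrite /A -[leRHS]mulrA ler_pM2l ?mulr_gt0 ?subr_gt0//.
  apply: le_trans (enorm_row_mx_le _ _) _; rewrite enormN enormZ.
  have [dx dy] := enorm_row_mx_ge (x k.+1 - x k) (y k.+1 - y k).
  rewrite -zdiff in dx dy.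
  set D := enorm (z k.+1 - z k) in dx dy *.
  have scal t u : 0 < t <= c -> 0 <= u <= D -> `|2 * t| * u <= 2 * c * D.
    move=> /andP[t0 tc] /andP[u0 uD]; rewrite gtr0_norm ?mulr_gt0//.
    by apply: ler_pM; rewrite ?mulr_ge0 ?(ltW t0)// ler_pM2l.
  have px := scal _ (enorm (x k.+1 - x k)) (_ : 0 < (2 * lam k)^-1 <= c).
  have py := scal _ (enorm (y k.+1 - y k)) (_ : 0 < (2 * mu k)^-1 <= c).
  have {}px : `|2 * (2 * lam k)^-1| * enorm (x k.+1 - x k) <= 2 * c * D.
    apply: px; rewrite ?enorm_ge0// invr_gt0 mulr_gt0//=.
    by have /andP[] := lam01 k.
  have {}py : `|2 * (2 * mu k)^-1| * enorm (y k.+1 - y k) <= 2 * c * D.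
    apply: py; rewrite ?enorm_ge0// invr_gt0 mulr_gt0//=.
    by have /andP[] := mu01 k.
  have lsub (w : 'rV[R]_(n + m)) : enorm (lsubmx w) <= enorm w.
    by rewrite -{2}(hsubmxK w) (enorm_row_mx_ge _ _).1.
  have mid : enorm (row_mx (x k.+1) (y k) - zs) < 1.
    move: z1' z2'; rewrite /z /zs !opp_row_mx !add_row_mx.
    have := (enorm_row_mx_ge (x k.+1 - xs) (y k.+1 - ys)).1.
    have := (enorm_row_mx_ge (x k - xs) (y k - ys)).2.
    have := enorm_row_mx_le (x k.+1 - xs) (y k - ys); lra.
  have lipk : enorm (gradient Q (z k.+1) - gradient Q (row_mx (x k.+1) (y k)))
      <= lip * D.
    apply: le_trans (Qlip _ _ _ mid) _; first by apply: lt_trans z1' _; lra.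
    rewrite ler_wpM2l// /z opp_row_mx add_row_mx subrr.
    by apply: le_trans (enorm_row_mx_le _ _) _; rewrite enorm0 add0r.
  apply: (@le_trans _ _ (lip * D + 2 * c * D + 2 * c * D)); last by lra.
  apply: lerD py; apply: le_trans (ler_enormD _ _) _; rewrite enormN enormZ.
  by apply: lerD px; exact: le_trans (lsub _) lipk.
have K1 k : (K <= k)%N -> (1 <= k)%N by apply: leq_trans.
have descK k (Kk : (K <= k)%N) := desc k (K1 k Kk).
have sposK k (Kk : (K <= k)%N) := spos k (K1 k Kk).
have s01 k : (K <= k)%N -> 0 < s k <= 1.
  move=> Kk; have sp := sposK _ Kk; rewrite sp /=.
  have := sN1 k; rewrite gtr0_norm// lt_min => h; apply: ltW.
  by have [|_ ->] := andP (h _) => //; apply: leq_trans Kk; rewrite leqW// leq_addl.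
split.
(* As s^0 = 1, the PLK inequality bounds the steps below, so the gaps cannot all stay positive. *)
- move=> q_0; exfalso.
  apply: (@no_sharp_descent _ s (fun k => enorm (z k.+1 - z k)) a A K) => //.
    by move=> k /sposK/ltW.
  by move=> k /plkK; rewrite q_0 powRr0.
- move=> q02; right.
  exact: (PLK_superlinear hcvg s_cvg a0 A0 q02 sposK descK plkK).
- move=> q_2; rewrite q_2 in plkK.
  exact: (PLK_linear hcvg a0 A0 s01 descK plkK).
- by move=> q2; exact: (PLK_polynomial hcvg a0 A0 q2 s01 descK plkK).
Qed.
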